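(* Let $(X,d)$ be a complete metric space with $|X|\geq 3$ and let $T\colon X\to X$ be an asymptotically regular generalized Kannan type mapping with the coefficient $\lambda\in[0,1)$. Then $T$ has a fixed point, and the number of fixed points of $T$ is at most two.
   Context: Let $(X,d)$ be a metric space with $|X|\geq 3$. A mapping $T\colon X\to X$ is a generalized Kannan type mapping with the coefficient $\lambda\in[0,1)$ if the inequality $$d(Tx,Ty)+d(Ty,Tz)+d(Tx,Tz)\leq \lambda\,(d(x,Tx)+d(y,Ty)+d(z,Tz))$$ holds for all three pairwise distinct points $x,y,z\in X$. A mapping $T\colon X\to X$ is asymptotically regular if $\lim_{n\to\infty} d(T^{n+1}(x),T^n(x))=0$ for all $x\in X$. *)

(* Defs.v *)
From HB Require Import structures.
From mathcomp Require Import all_boot all_order all_algebra.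
From mathcomp Require Import all_classical all_reals all_analysis.

Set Implicit Arguments.
Unset Strict Implicit.
Unset Printing Implicit Defensive.

Import Order.TTheory GRing.Theory Num.Theory.
Import numFieldNormedType.Exports.

Local Open Scope classical_set_scope.
Local Open Scope ring_scope.

(* [Complete] also carries a distinguished point; this only excludes the empty
   space. *)
#[short(type="completeMetricType")]
HB.structure Definition CompleteMetric (K : numDomainType) :=
  { M of Metric K M & Complete M }.

Definition generalized_kannan (R : realType) (X : metricType R)
    (lambda : R) (T : X -> X) : Prop :=
  forall x y z : X, x != y -> y != z -> x != z ->
    mdist (T x) (T y) + mdist (T y) (T z) + mdist (T x) (T z)
      <= lambda * (mdist x (T x) + mdist y (T y) + mdist z (T z)).

Definition asymptotically_regular (R : realType) (X : metricType R)
    (T : X -> X) : Prop :=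
  forall x : X, mdist (iter n.+1 T x) (iter n T x) @[n --> \oo] --> (0 : R).

Definition fixed_points (X : Type) (T : X -> X) : set X := [set x | T x = x].

(* Main.v *)
Require Import Defs.
From HB Require Import structures.
From mathcomp Require Import all_boot all_order all_algebra.
From mathcomp Require Import all_classical all_reals all_analysis.
From mathcomp Require Import zify lra.

Set Implicit Arguments.
Unset Strict Implicit.
Unset Printing Implicit Defensive.

Import Order.TTheory GRing.Theory Num.Theory.
Import numFieldNormedType.Exports.

Local Open Scope classical_set_scope.
Local Open Scope card_scope.
Local Open Scope ring_scope.

(** Three distinct fixed points would make the right-hand side of the Kannan
    inequality vanish and force them to coincide; hence there are at most two.

    For existence, suppose that there is no fixed point and follow the orbit
    [x_n] of any point. A periodic orbit repeats the same step length forever,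
    so asymptotic regularity would make that step zero, and the period would
    contain a fixed point; therefore the orbit never repeats
    ([orbit_injective]). This is what makes the three-point inequality usable:
    any two orbit points can be completed to a distinct triple by a later one,
    and the inequality then bounds [d(x_(n+1), x_(m+1))] by three step lengths,
    all of them small. The orbit is Cauchy ([orbit_cauchy]). At its limit [p]
    the inequality for the triple [p, x_n, x_(n+1)] becomes in the limit
    [d(p, Tp) <= lambda d(p, Tp)], so [p] is a fixed point after all
    ([orbit_limit_fixed]). *)

Lemma regular_step_lt (R : realType) (X : metricType R) (T : X -> X) (x : X)
    (e : R) : asymptotically_regular T -> 0 < e ->
  \forall n \near \oo, mdist (iter n T x) (iter n.+1 T x) < e.
Proof.
move=> regT e0; have [N _ small] := cvgr0_norm_lt _ (regT x) _ e0.
exists N => // n /small /=.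
by rewrite ger0_norm ?mdist_ge0 // metric_sym.
Qed.

(** The step from [y] to [T y] recurs along the orbit of [y] at every multiple
    of the period, while the steps tend to zero. *)
Lemma regular_periodic_fixed (R : realType) (X : metricType R) (T : X -> X)
    (y : X) (k : nat) : asymptotically_regular T ->
  iter k.+1 T y = y -> T y = y.
Proof.
move=> regT yk; apply/eqP/negP => /negP; rewrite eq_sym -mdist_gt0 => Ty.
have [N _ small] := regular_step_lt y regT Ty.
have := small (N * k.+1)%N (leq_pmulr _ (ltn0Sn k)).
have yN : iter (N * k.+1) T y = y by rewrite iterM; exact: iter_fix.
by rewrite iterS yN ltxx.
Qed.

Lemma orbit_injective (R : realType) (X : metricType R) (T : X -> X) (x : X) :
  asymptotically_regular T -> (forall y, T y <> y) ->
  injective (fun n => iter n T x).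
Proof.
move=> regT nofix.
have ltN m n : (m < n)%N -> iter m T x <> iter n T x.
  move=> mn E; apply: (nofix (iter m T x)).
  apply: (@regular_periodic_fixed _ _ _ _ (n - m).-1 regT).
  by rewrite prednK ?subn_gt0 // -iterD subnK // ltnW.
move=> m n E; case: (ltngtP m n) => // /ltN; first by move/(_ E).
by move/(_ (esym E)).
Qed.

Lemma kannan_dist_le (R : realType) (X : metricType R) (lambda : R) (T : X -> X)
    (x y z : X) : generalized_kannan lambda T ->
  x != y -> y != z -> x != z ->
  mdist (T x) (T y) <= lambda * (mdist x (T x) + mdist y (T y) + mdist z (T z)).
Proof.
move=> kT xy yz xz; apply: le_trans (kT _ _ _ xy yz xz).
by rewrite -addrA lerDl addr_ge0 // mdist_ge0.
Qed.

(** The Kannan inequality bounds distances between images by step lengths, so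
    the distances between late orbit points are small without any summation
    along the orbit. *)
Lemma orbit_cauchy (R : realType) (X : metricType R) (lambda : R) (T : X -> X)
    (x : X) : lambda <= 1 -> generalized_kannan lambda T ->
  asymptotically_regular T -> injective (fun n => iter n T x) ->
  cauchy ((fun n => iter n T x) @ \oo).
Proof.
move=> l1 kT regT inj; apply: cauchy_exP => e e0.
have e3 : 0 < e / 3 by rewrite divr_gt0.
have [N _ small] := regular_step_lt x regT e3.
exists (iter N.+1 T x); exists N.+2 => // -[//|m] /= Nm.
rewrite ballEmdist /=.
have neq i j : i != j -> iter i T x != iter j T x.
  by apply: contra_neq => /inj.
(* [N + m + 1] is an index beyond both [N] and [m]: the third point. *)
have := @kannan_dist_le _ _ _ _ _ _ (iter (N + m).+1 T x) kT
  (neq N m ltac:(lia)) (neq m (N + m).+1 ltac:(lia)) (neq N (N + m).+1 ltac:(lia)).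
have := small N (leqnn N); have := small m ltac:(rewrite /=; lia).
have := small (N + m).+1 ltac:(rewrite /=; lia).
rewrite !iterS.
have := mdist_ge0 (iter N T x) (T (iter N T x)).
have := mdist_ge0 (iter m T x) (T (iter m T x)).
have := mdist_ge0 (T (iter (N + m) T x)) (T (T (iter (N + m) T x))).
move: (mdist _ (T (T _))) (mdist (iter m _ _) _) (mdist (iter N _ _) _) => a b c.
move: (mdist _ _) => d; nra.
Qed.

(** [T] need not be continuous: [d(Tp, x_(n+1))] is controlled by the Kannan
    inequality instead. Injectivity of the orbit keeps [p, x_n, x_(n+1)]
    pairwise distinct for large [n], since the orbit meets [p] at most once. *)
Lemma orbit_limit_fixed (R : realType) (X : metricType R) (lambda : R)
    (T : X -> X) (x p : X) : 0 <= lambda < 1 -> generalized_kannan lambda T ->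
  asymptotically_regular T -> injective (fun n => iter n T x) ->
  iter n T x @[n --> \oo] --> p -> T p = p.
Proof.
move=> /andP[l0 l1] kT regT inj xp.
apply/eqP/negP => /negP; rewrite eq_sym -mdist_gt0 => D0.
(* If the steps [d(x_n, x_(n+1))] and the distances [d(p, x_n)] are below [e],
   then [d(p, Tp) < e + lambda (d(p, Tp) + 2 e)], hence
   [(1 - lambda) d(p, Tp) < 3 e]; this [e] makes that absurd. *)
pose e : R := (1 - lambda) * mdist p (T p) / 3.
have e0 : 0 < e by rewrite divr_gt0 // mulr_gt0 // subr_gt0.
have neqS n : iter n T x != iter n.+1 T x by apply/eqP => /inj; lia.
have neq_p : \forall n \near \oo, iter n T x != p.
  have [[k kp]|np] := pselect (exists k, iter k T x = p); last first.
    by apply: nearW => n; apply/eqP => np'; apply: np; exists n.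
  exists k.+1 => // n /= kn; apply/eqP; rewrite -kp => /inj; lia.
have near_p := metricType_numDomainType.cvgr_dist_lt xp e0.
have [N _ far] : \forall n \near \oo, [/\ iter n T x != p, mdist p (iter n T x) < e
    & mdist (iter n T x) (iter n.+1 T x) < e].
  near=> n; split; near: n => //; first exact: near_p.
  exact: regular_step_lt.
have [pN _ sN] := far N (leqnn N).
have [pN1 dN1 sN1] := far N.+1 (leqnSn N).
rewrite eq_sym in pN; rewrite eq_sym in pN1.
have := kannan_dist_le kT pN (neqS N) pN1.
have := metric_triangle p (iter N.+1 T x) (T p).
move: dN1 sN sN1; rewrite [mdist (iter N.+1 T x) (T p)]metric_sym !iterS /e.
have := mdist_ge0 (iter N T x) (T (iter N T x)).
have := mdist_ge0 (T (iter N T x)) (T (T (iter N T x))).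
move: (mdist _ (T (T _))) (mdist (iter N _ _) _) (mdist (T p) _) (mdist p (T (iter _ _ _))) => a b c d.
move: (mdist _ _) D0 => D *; nra.
Unshelve. all: by end_near. Qed.

Lemma kannan_fixed_points_eq (R : realType) (X : metricType R) (lambda : R)
    (T : X -> X) (x y z : X) : generalized_kannan lambda T ->
  T x = x -> T y = y -> T z = z -> x != y -> y != z -> x = z.
Proof.
move=> kT Tx Ty Tz xy yz; apply/eqP/negP => /negP xz.
have := kannan_dist_le kT xy yz xz; rewrite Tx Ty Tz !mdistxx !addr0 mulr0.
by rewrite leNgt mdist_gt0 xy.
Qed.

Theorem theorem4p3 (R : realType) (X : completeMetricType R)
    (card_X : `I_3 #<= [set: X])
    (lambda : R) (lambda01 : 0 <= lambda < 1)
    (T : X -> X)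
    (T_kannan : generalized_kannan lambda T)
    (T_regular : asymptotically_regular T) :
  fixed_points T !=set0 /\ fixed_points T #<= `I_2.
Proof.
have [p Tp] : fixed_points T !=set0.
  apply: contrapT => nofix.
  have inj : injective (fun n => iter n T (point : X)).
    by apply: orbit_injective => // y Ty; apply: nofix; exists y.
  apply: nofix; exists (lim (iter n T (point : X) @[n --> \oo])).
  apply: (orbit_limit_fixed lambda01 T_kannan T_regular inj).
  apply: cauchy_cvg; apply: (orbit_cauchy _ T_kannan T_regular inj).
  by have /andP[_ /ltW] := lambda01.
split; first by exists p.
have [q fix_pq] : exists q, fixed_points T `<=` [set p; q].
  have [[q [Tq pq]]|only_p] := pselect (exists q, T q = q /\ p != q); last first.
    exists p => r Tr; left; apply/esym/eqP/negP => /negP pr.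
    by apply: only_p; exists r.
  exists q => r Tr; have [->|qr] := eqVneq q r; first by right.
  by left; apply/esym; exact: (kannan_fixed_points_eq T_kannan Tp Tq Tr).
have pq_image : [set p; q] = (fun n => if n is 0%N then p else q) @` `I_2.
  apply/seteqP; split=> [r [->|->]|r [[|n] _ <-]]; [| |by left|by right].
    by exists 0%N.
  by exists 1%N.
apply: card_le_trans (subset_card_le fix_pq) _.
by rewrite pq_image; exact: card_image_le.
Qed.
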